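(* Let $n\ge3$ and let $\Sigma\subset S^{n-1}$ be an $(n-2)$-dimensional $C^2$ manifold, given as the image of a $C^2$ diffeomorphism from $[0,1]^{n-2}$ onto its image, which has non-vanishing geodesic curvature if $n=3$ and sectional curvature $>1$ if $n\ge4$. For $z\in\mathbb{R}^n$ let $$\mathcal{C}_z=\bigcup_{p\in\Sigma,\ r\in[-1,1]}\{z+rp\}\subset\mathbb{R}^n.$$ If a line $L\subset\mathbb{R}^n$ satisfies $\min_{p\in\mathcal{C}_z\setminus\{z\}}\angle(L,T_p\mathcal{C}_z)\ge a$ for some $a\gg\delta>0$, then $$\mathcal{L}^n(\mathcal{C}_z^\delta\cap L^\delta)\lesssim_a\delta^n .$$
   Context: $S^{n-1}$ is the unit sphere of $\mathbb{R}^n$; $\mathcal{L}^n$ is Lebesgue measure; $A^\delta$ is the $\delta$-neighbourhood in $\mathbb{R}^n$ of a set $A\subset\mathbb{R}^n$. $\mathcal{C}_z$ is the (truncated, two-sided) cone with apex $z$ and cross-section $\Sigma$. For $p\ne z$ in $\mathcal{C}_z$, $T_p\mathcal{C}_z$ is its tangent hyperplane: if $p=z+rq$ with $q\in\Sigma$, $r\neq0$, it is the linear hyperplane $\mathrm{span}\{q\}\oplus T_q\Sigma$. The angle $\angle(L,W)$ between a line $L$ and a linear subspace $W$ is the angle between the direction of $L$ and its orthogonal projection to $W$. $a\gg\delta$ means that $\delta$ is sufficiently small compared with $a$. $A\lesssim_a B$ means $A\le CB$ with a constant $C$ that may depend on $a$, $n$ and $\Sigma$, but not on $\delta$, $z$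 or $L$. For $n\ge4$, sectional curvature $>1$ is equivalent (Gauss equation) to all principal curvatures of $\Sigma$ in $S^{n-1}$ at each point being nonzero and of the same sign. *)

(* Defs.v *)
From HB Require Import structures.
From mathcomp Require Import all_boot all_order all_algebra.
From mathcomp Require Import all_classical all_reals all_analysis.
Import Order.TTheory GRing.Theory Num.Theory.
Import numFieldNormedType.Exports.

Set Implicit Arguments.
Unset Strict Implicit.
Unset Printing Implicit Defensive.

Local Open Scope classical_set_scope.
Local Open Scope ring_scope.

(* The library norm on 'rV[R]_n is the sup norm, hence the Euclidean structure
   below. The two norms induce the same topology and derivatives. *)

Definition dot (R : realType) (n : nat) (u v : 'rV[R]_n) : R :=
  \sum_i u 0 i * v 0 i.

Definition enorm (R : realType) (n : nat) (u : 'rV[R]_n) : R :=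
  Num.sqrt (dot u u).

Definition unit_sphere (R : realType) (n : nat) : set 'rV[R]_n :=
  [set p | enorm p = 1].

Definition thickening (R : realType) (n : nat) (delta : R) (A : set 'rV[R]_n) :
    set 'rV[R]_n :=
  [set x | exists2 y, A y & enorm (x - y) < delta].

Definition line (R : realType) (n : nat) (b v : 'rV[R]_n) : set 'rV[R]_n :=
  [set b + t *: v | t in [set: R]].

Definition unit_cube (R : realType) (m : nat) : set 'rV[R]_m :=
  [set x | forall i, 0 <= x 0 i <= 1].

(* Linear subspaces of R^n are row spaces of matrices. The row space of
   kermx W^T is the orthogonal complement of that of W. *)
Definition orthproj (R : realType) (k n : nat) (W : 'M[R]_(k, n))
    (v : 'rV[R]_n) : 'rV[R]_n :=
  v *m proj_mx <<W>>%MS (kermx W^T).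

(* If one of the vectors is 0 the quotient is 0 and the angle is pi / 2. *)
Definition vangle (R : realType) (n : nat) (u v : 'rV[R]_n) : R :=
  acos (dot u v / (enorm u * enorm v)).

(* The same for v and for - v, hence a function of the line R v. *)
Definition angle (R : realType) (k n : nat) (v : 'rV[R]_n)
    (W : 'M[R]_(k, n)) : R :=
  vangle v (orthproj W v).

Definition C1_on (R : realType) (m n : nat) (U : set 'rV[R]_m)
    (f : 'rV[R]_m -> 'rV[R]_n) : Prop :=
  forall x, U x ->
    differentiable f x /\ forall v, {for x, continuous ('D_v f)}.

Definition C2_on (R : realType) (m n : nat) (U : set 'rV[R]_m)
    (f : 'rV[R]_m -> 'rV[R]_n) : Prop :=
  C1_on U f /\ forall v, C1_on U ('D_v f).

Definition C2_around (R : realType) (m n : nat) (A : set 'rV[R]_m)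
    (f : 'rV[R]_m -> 'rV[R]_n) : Prop :=
  exists U, [/\ open U, A `<=` U & C2_on U f].

(* f stands for a map on A together with a C^2 extension of it to a
   neighbourhood; its values far from A are irrelevant. *)
Definition C2_diffeo_onto_image (R : realType) (m n : nat) (A : set 'rV[R]_m)
    (f : 'rV[R]_m -> 'rV[R]_n) : Prop :=
  C2_around A f /\
  exists g : 'rV[R]_n -> 'rV[R]_m,
    C2_around (f @` A) g /\ forall x, A x -> g (f x) = x.

Section Curvature.
Variables (R : realType) (m n : nat) (f : 'rV[R]_m -> 'rV[R]_n).

(* Second fundamental form in R^n of the manifold parametrised by f, at f x, on
   the tangent vectors 'D_u f x and 'D_v f x: the normal component of the second
   derivative of f. The row space of 'J f x is the tangent space. *)
Definition second_fundamental_form (x u v : 'rV[R]_m) : 'rV[R]_n :=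
  let w := 'D_v ('D_u f) x in w - orthproj ('J f x) w.

(* Sectional curvature of the plane spanned by 'D_u f x and 'D_v f x, by the
   Gauss equation in the flat space R^n. A C^2 submanifold has only a C^1
   metric, for which the intrinsic formula is not available. *)
Definition sectional_curvature (x u v : 'rV[R]_m) : R :=
  let II := second_fundamental_form x in
  (dot (II u u) (II v v) - dot (II u v) (II u v)) /
  (dot ('D_u f x) ('D_u f x) * dot ('D_v f x) ('D_v f x)
     - dot ('D_u f x) ('D_v f x) ^+ 2).

(* Unsigned geodesic curvature in the unit sphere, at t = 0, of the curve
   t |-> f (x + t *: u), which need not have unit speed: the component of the
   acceleration orthogonal to the velocity and to the normal f x of the sphere,
   divided by the squared speed. *)
Definition geodesic_curvature (x u : 'rV[R]_m) : R :=
  let w := 'D_u ('D_u f) x in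
  enorm (w - orthproj (f x + 'D_u f x)%MS w) / enorm ('D_u f x) ^+ 2.

End Curvature.

Definition cone (R : realType) (n : nat) (Sigma : set 'rV[R]_n)
    (z : 'rV[R]_n) : set 'rV[R]_n :=
  [set x | exists p r, [/\ Sigma p, -1 <= r <= 1 & x = z + r *: p]].

(* W is the tangent hyperplane at p of the cone over f @` unit_cube. A relation,
   since p has two representations when the cross-section contains antipodal
   points. *)
Definition cone_tangent (R : realType) (m n : nat) (f : 'rV[R]_m -> 'rV[R]_n)
    (z p : 'rV[R]_n) (W : 'M[R]_n) : Prop :=
  exists x r, [/\ @unit_cube R m x, -1 <= r <= 1, r != 0, p = z + r *: f x
    & W = (f x + 'J f x)%MS].

(* n-dimensional Lebesgue outer measure, i.e. Lebesgue measure on measurable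
   sets, in particular on open sets. *)

Definition box (R : realType) (n : nat) (ab : 'rV[R]_n * 'rV[R]_n) :
    set 'rV[R]_n :=
  [set x | forall i, ab.1 0 i <= x 0 i <= ab.2 0 i].

Definition box_volume (R : realType) (n : nat) (ab : 'rV[R]_n * 'rV[R]_n) : R :=
  \prod_i Num.max 0 (ab.2 0 i - ab.1 0 i).

Definition lebesgue_n (R : realType) (n : nat) (A : set 'rV[R]_n) : \bar R :=
  ereal_inf [set (\sum_(0 <= k <oo) (box_volume (ab k))%:E)%E |
    ab in [set ab : nat -> 'rV[R]_n * 'rV[R]_n |
           A `<=` \bigcup_k box (ab k)]].

(* Main.v *)
(* Let y = z + r f(x) and y' = z + r' f(x') be points of the cone within 2 delta
   of the points b + t v and b + t' v of the line, with x and x' close to x0.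
   Since f is strictly differentiable at x0, y' - y differs from
   (r' - r) f(x0) + r' 'd f x0 (x' - x), a vector of the tangent hyperplane W of
   the cone at z + f(x0), by an error of at most a small multiple of
   |r' - r| + |r'| |x' - x|; and this sum is O(|y' - y|), because f takes values
   in the unit sphere and has a Lipschitz inverse. As (t' - t) v lies at distance
   at least s |t' - t| |v| from W, with s > 0 depending only on the angle a, it
   follows that |t' - t| |v| = O(delta / s). The bound is scale invariant in r, so
   the apex needs no separate treatment. The cube is covered by finitely many
   such neighbourhoods, in number depending on a, and each of them contributes
   one box of side O(delta). *)

Require Import Defs.
From HB Require Import structures.
From mathcomp Require Import all_boot all_order all_algebra.
From mathcomp Require Import all_classical all_reals all_analysis.
From mathcomp Require Import ring lra.
Import Order.TTheory GRing.Theory Num.Theory.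
Import numFieldNormedType.Exports.

Set Implicit Arguments.
Unset Strict Implicit.
Unset Printing Implicit Defensive.

Local Open Scope classical_set_scope.
Local Open Scope ring_scope.

(** * Sup norm, dot product and Euclidean norm *)

Lemma coord_le_norm (R : realType) (n : nat) (u : 'rV[R]_n) (i : 'I_n) :
  `|u 0 i| <= `|u|.
Proof.
rewrite [in leRHS]/Num.norm /= mx_normrE.
exact: (le_bigmax _ (fun ij : 'I_1 * 'I_n => `|u ij.1 ij.2|) (0, i)).
Qed.

Lemma norm_le_coord (R : realType) (n : nat) (u : 'rV[R]_n) (c : R) :
  0 <= c -> (forall i, `|u 0 i| <= c) -> `|u| <= c.
Proof.
move=> c0 uc; rewrite /Num.norm /= mx_normrE.
by apply: bigmax_le => // -[i j] _ /=; rewrite (ord1 i).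
Qed.

Lemma dotC (R : realType) (n : nat) (u v : 'rV[R]_n) : dot u v = dot v u.
Proof. by apply: eq_bigr => i _; rewrite mulrC. Qed.

Lemma dotDl (R : realType) (n : nat) (u v w : 'rV[R]_n) :
  dot (u + v) w = dot u w + dot v w.
Proof. by rewrite -big_split; apply: eq_bigr => i _; rewrite mxE mulrDl. Qed.

Lemma dotZl (R : realType) (n : nat) (c : R) (u w : 'rV[R]_n) :
  dot (c *: u) w = c * dot u w.
Proof. by rewrite mulr_sumr; apply: eq_bigr => i _; rewrite mxE mulrA. Qed.

Lemma dotNl (R : realType) (n : nat) (u w : 'rV[R]_n) :
  dot (- u) w = - dot u w.
Proof. by rewrite -scaleN1r dotZl mulN1r. Qed.

Lemma dotDr (R : realType) (n : nat) (u v w : 'rV[R]_n) :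
  dot w (u + v) = dot w u + dot w v.
Proof. by rewrite dotC dotDl !(dotC w). Qed.

Lemma dotZr (R : realType) (n : nat) (c : R) (u w : 'rV[R]_n) :
  dot w (c *: u) = c * dot w u.
Proof. by rewrite dotC dotZl (dotC w). Qed.

Lemma dotNr (R : realType) (n : nat) (u w : 'rV[R]_n) :
  dot w (- u) = - dot w u.
Proof. by rewrite dotC dotNl (dotC w). Qed.

Definition dotE := (dotDl, dotDr, dotNl, dotNr, dotZl, dotZr).

Lemma dot_pythagoras (R : realType) (n : nat) (u v : 'rV[R]_n) :
  dot u v = 0 -> dot (u + v) (u + v) = dot u u + dot v v.
Proof. by move=> uv; rewrite !dotE (dotC v u) uv addr0 add0r. Qed.

Lemma dot_mulmx (R : realType) (n : nat) (u v : 'rV[R]_n) :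
  u *m v^T = (dot u v)%:M.
Proof.
apply/matrixP => i j; rewrite !ord1 !mxE eqxx mulr1n.
by apply: eq_bigr => k _; rewrite mxE.
Qed.

Lemma dot_ge0 (R : realType) (n : nat) (u : 'rV[R]_n) : 0 <= dot u u.
Proof. by apply: sumr_ge0 => i _; rewrite -expr2 sqr_ge0. Qed.

Lemma sqr_enorm (R : realType) (n : nat) (u : 'rV[R]_n) :
  enorm u ^+ 2 = dot u u.
Proof. by rewrite sqr_sqrtr ?dot_ge0. Qed.

Lemma enorm_ge0 (R : realType) (n : nat) (u : 'rV[R]_n) : 0 <= enorm u.
Proof. exact: sqrtr_ge0. Qed.

Lemma norm_le_enorm (R : realType) (n : nat) (u : 'rV[R]_n) : `|u| <= enorm u.
Proof.
apply: norm_le_coord => [|i]; first exact: enorm_ge0.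
rewrite -sqrtr_sqr ler_sqrt ?dot_ge0// /dot (bigD1 i)//= expr2 lerDl.
by apply: sumr_ge0 => j _; rewrite -expr2 sqr_ge0.
Qed.

Lemma enorm_le_norm (R : realType) (n : nat) (u : 'rV[R]_n) :
  enorm u <= n%:R * `|u|.
Proof.
have nu0 : 0 <= n%:R * `|u| by rewrite mulr_ge0.
rewrite -[leRHS]ger0_norm // -sqrtr_sqr ler_sqrt ?sqr_ge0 //.
apply: (@le_trans _ _ (n%:R * `|u| ^+ 2)).
  have -> : n%:R * `|u| ^+ 2 = \sum_(i < n) `|u| ^+ 2.
    by rewrite sumr_const card_ord mulr_natl.
  apply: ler_sum => i _; rewrite -expr2 -real_normK ?num_real//.
  by rewrite lerXn2r ?nnegrE// coord_le_norm.
rewrite exprMn ler_wpM2r ?sqr_ge0// expr2 -natrM ler_nat.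
by case: n {u nu0} => // n; rewrite leq_pmulr.
Qed.

Lemma dot_eq0 (R : realType) (n : nat) (u : 'rV[R]_n) : dot u u = 0 -> u = 0.
Proof.
move=> uu; apply/eqP; rewrite -normr_le0.
by apply: (le_trans (norm_le_enorm _)); rewrite /enorm uu sqrtr0.
Qed.

(** * Orthogonal projection and the angle with a subspace *)

Lemma dot_kermx (R : realType) (k n : nat) (W : 'M[R]_(k, n)) (u w : 'rV[R]_n) :
  (u <= kermx W^T)%MS -> (w <= W)%MS -> dot u w = 0.
Proof.
move=> /sub_kermxP uW /submxP[c wE].
have : (dot u w)%:M = (0 : 'M[R]_1).
  by rewrite -dot_mulmx wE trmx_mul mulmxA uW mul0mx.
by move=> /matrixP/(_ 0 0); rewrite !mxE eqxx mulr1n.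
Qed.

Lemma orthproj_sub (R : realType) (k n : nat) (W : 'M[R]_(k, n))
  (v : 'rV[R]_n) : (orthproj W v <= W)%MS.
Proof. by rewrite (submx_trans (proj_mx_sub _ _ _)) ?genmxE. Qed.

(** A vector in both [W] and its complement is orthogonal to itself, hence 0. The sum is therefore
    direct, the ranks add up to [n], and the two spaces span everything. *)
Lemma orthproj_compl_sub (R : realType) (k n : nat) (W : 'M[R]_(k, n))
  (v : 'rV[R]_n) : (v - orthproj W v <= kermx W^T)%MS.
Proof.
apply: proj_mx_compl_sub; apply: submx_full; rewrite /row_full.
have dx : mxdirect (<<W>> + kermx W^T).
  apply/mxdirect_addsP/eqP; rewrite -submx0; apply/row_subP => i.
  have : (row i (<<W>> :&: kermx W^T) <= <<W>> :&: kermx W^T)%MS.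
    exact: row_sub.
  rewrite sub_capmx genmxE => /andP[rW rK].
  by rewrite (dot_eq0 (dot_kermx rK rW)) sub0mx.
rewrite (mxdirectP dx) /= genmxE mxrank_ker mxrank_tr subnKC//.
exact: rank_leq_col.
Qed.

(** With [P] the projection of [v], the angle has cosine [y], the quotient of the lengths of [P] and
    [v]. By Pythagoras no point of [W] is closer to [v] than [P], and the squared distance is
    [1 - y ^+ 2] times that of [v] from 0. *)
Lemma angle_transversal (R : realType) (a : R) : 0 < a ->
  exists2 s : R, 0 < s &
  forall (k n : nat) (v : 'rV[R]_n) (W : 'M[R]_(k, n)), a <= angle v W ->
  forall w : 'rV[R]_n, (w <= W)%MS -> s * enorm v <= enorm (v - w).
Proof.
move=> a0.
have cosy (k n : nat) (v : 'rV[R]_n) (W : 'M[R]_(k, n)) :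
    0 <= enorm (orthproj W v) / enorm v <= 1 /\
    angle v W = acos (enorm (orthproj W v) / enorm v).
  set P := orthproj W v; set N := v - P.
  have NP : dot N P = 0.
    exact: dot_kermx (orthproj_compl_sub _ _) (orthproj_sub _ _).
  have vE : N + P = v by rewrite subrK.
  have Pv : enorm P <= enorm v.
    rewrite /enorm ler_sqrt ?dot_ge0//.
    have : dot v v = dot N N + dot P P.
      by rewrite -[in LHS]vE dot_pythagoras.
    by move->; rewrite lerDr dot_ge0.
  split.
    rewrite divr_ge0 ?enorm_ge0//=.
    have [->|v0] := eqVneq (enorm v) 0; first by rewrite invr0 mulr0.
    by rewrite ler_pdivrMr ?mul1r// lt_def v0 enorm_ge0.
  rewrite /angle /vangle -/P; congr acos.
  have -> : dot v P = dot P P by rewrite -[in LHS]vE dotDl NP add0r.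
  rewrite -sqr_enorm invfM.
  have [->|P0] := eqVneq (enorm P) 0; first by rewrite expr2 !mul0r.
  by rewrite expr2 mulrACA divff// mulr1.
(* An arc cosine never exceeds [pi], so for larger [a] the hypothesis is void. *)
have [api|api] := leP a pi; last first.
  exists 1 => // k n v W aW; have [y01 aE] := cosy k n v W.
  suff : angle v W <= pi by lra.
  by rewrite aE acos_lepi//; lra.
have cosa : cos a < 1.
  by rewrite -cos0 ltr_cos// in_itv/=; lra.
(* From [0 <= y <= 1] and [y <= cos a] follows [1 - y ^+ 2 >= 1 - y >= 1 - cos a]. Unlike the sine
   of [a], this is still positive at [a = pi]. *)
exists (Num.sqrt (1 - cos a)) => [|k n v W aW w wW].
  by rewrite sqrtr_gt0 subr_gt0.
have [y01 aE] := cosy k n v W.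
move: aW; rewrite {}aE; set P := orthproj W v in y01 *.
set y := _ / _ in y01 * => aW.
have ycos : y <= cos a.
  have y11 : -1 <= y <= 1 by lra.
  have [/andP[ac0 acpi] <-] := acos_def y11.
  by rewrite leNgt ltr_cos ?in_itv/=; lra.
set N := v - P.
have NW u : (u <= W)%MS -> dot N u = 0.
  exact/dot_kermx/orthproj_compl_sub.
have PW : (P <= W)%MS by exact: orthproj_sub.
have vE : N + P = v by rewrite subrK.
rewrite -sqrtrM; last by lra.
apply: (@le_trans _ _ (Num.sqrt (dot N N))); last first.
  rewrite ler_sqrt ?dot_ge0// -vE -addrA.
  have /NW : (P - w <= W)%MS by rewrite addmx_sub ?eqmx_opp.
  by move=> /dot_pythagoras ->; rewrite lerDl dot_ge0.
rewrite ler_sqrt ?dot_ge0//.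
have Ev : enorm P = y * enorm v.
  rewrite /y; have [v0|v0] := eqVneq (enorm v) 0; last by rewrite divfK.
  have : dot v v = 0 by rewrite -sqr_enorm v0 expr0n.
  by move=> /dot_eq0 vv; rewrite v0 mulr0 /P vv /orthproj mul0mx /enorm /dot
    big1 ?sqrtr0// => i _; rewrite !mxE mul0r.
have : dot v v = dot N N + dot P P.
  by rewrite -[in LHS]vE dot_pythagoras// NW.
rewrite -(sqr_enorm P) Ev exprMn sqr_enorm; have := dot_ge0 v.
set V := dot v v; set NN := dot N N => V0 VE.
have -> : NN = (1 - y ^+ 2) * V by lra.
have : y ^+ 2 <= y by rewrite expr2 ler_piMr; lra.
by move=> yy; rewrite ler_wpM2r//; lra.
Qed.

(** * Strict differentiability and Lipschitz bounds for C^1 maps *)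

Lemma C1_on_line_derivable (R : realType) (m n : nat) (U : set 'rV[R]_m)
  (f : 'rV[R]_m -> 'rV[R]_n) (x h : 'rV[R]_m) (t : R) (j : 'I_n) :
  C1_on U f -> U (x + t *: h) ->
  is_derive t 1 (fun s : R => f (x + s *: h) 0 j) (('D_h f (x + t *: h)) 0 j).
Proof.
move=> fU /fU[df _].
have shiftE : (fun s : R => s^-1 *:
      (((fun s : R => f (x + s *: h)) \o shift t) (s *: 1) - f (x + t *: h))) =
    (fun s : R => s^-1 *:
      ((f \o shift (x + t *: h)) (s *: h) - f (x + t *: h))).
  apply/funext => s /=; congr (_ *: (f _ - _)).
  by rewrite [s *: 1]mulr1 scalerDl addrCA.
have dphi : derivable (fun s : R => f (x + s *: h)) t 1.
  by rewrite /derivable shiftE; exact: diff_derivable.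
have dphij : derivable (fun s : R => f (x + s *: h) 0 j) t 1.
  exact: (derivable_mxP _ _ _).1 dphi 0 j.
apply: (DeriveDef dphij).
transitivity (('D_1 (fun s : R => f (x + s *: h)) t) 0 j).
  by rewrite derive_mx// mxE.
by rewrite /derive shiftE.
Qed.

(** The mean value theorem, applied to each coordinate along the segment from [x] to [y], gives the
    increment as a directional derivative at an intermediate point, which depends on the coordinate.
    Its expansion in partial derivatives, continuous at [x0], is then compared with that of
    ['d f x0]. *)
Lemma C1_on_strict_diff (R : realType) (m n : nat) (U : set 'rV[R]_m)
  (f : 'rV[R]_m -> 'rV[R]_n) (x0 : 'rV[R]_m) (e : R) :
  open U -> C1_on U f -> U x0 -> 0 < e ->
  exists2 d : R, 0 < d & forall x y : 'rV[R]_m,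
    `|x - x0| < d -> `|y - x0| < d ->
    `|f y - f x - 'd f x0 (y - x)| <= e * `|y - x|.
Proof.
move=> oU fU Ux0 e0.
(* The errors of [m] partial derivatives are added up; [m.+1] avoids a division by 0. *)
pose e' := e / m.+1%:R; have e'0 : 0 < e' by rewrite divr_gt0.
have Dnear : \forall y \near x0,
    forall i : 'I_m, `|'D_('e_i) f x0 - 'D_('e_i) f y| < e'.
  apply: (@filter_forall _ _
    (fun i => [set y | `|'D_('e_i) f x0 - 'D_('e_i) f y| < e']) (nbhs x0)
    (nbhs_filter x0)) => i.
  exact: (cvgrPdist_lt _ _).1 ((fU x0 Ux0).2 'e_i) e' e'0.
have /nbhs_normP[d /= d0 dP] : \forall y \near x0, U y /\
    forall i : 'I_m, `|'D_('e_i) f x0 - 'D_('e_i) f y| < e'.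
  exact: filterI (open_nbhs_nbhs (conj oU Ux0)) Dnear.
exists d => // x y xd yd.
have diffE p (h : 'rV[R]_m) : U p -> 'd f p h = \sum_i h 0 i *: 'D_('e_i) f p.
  move=> /fU[df _]; rewrite {1}(row_sum_delta h) linear_sum.
  by apply: eq_bigr => i _; rewrite linearZ /= deriveE.
set h := y - x.
(* The ball is convex, so intermediate points stay where the partial derivatives are controlled. *)
have seg (t : R) : 0 <= t <= 1 -> ball_ Num.norm x0 d (x + t *: h).
  move=> t01; rewrite /= distrC.
  have -> : x + t *: h - x0 = (1 - t) *: (x - x0) + t *: (y - x0).
    by rewrite /h scalerBl scale1r !scalerBr; apply/rowP => i; rewrite !mxE; ring.
  apply: le_lt_trans (ler_normD _ _) _; rewrite !normrZ !ger0_norm; try lra.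
  have : Num.max `|x - x0| `|y - x0| < d by rewrite gt_max xd.
  apply: le_lt_trans; set M := Num.max _ _.
  have Mx : `|x - x0| <= M by rewrite le_max lexx.
  have My : `|y - x0| <= M by rewrite le_max lexx orbT.
  rewrite [leRHS](_ : M = (1 - t) * M + t * M); last by ring.
  by rewrite lerD// ler_wpM2l//; lra.
apply: norm_le_coord => [|j]; first by rewrite mulr_ge0// ltW.
have dt (t : R) : 0 <= t <= 1 ->
    is_derive t 1 (fun s : R => f (x + s *: h) 0 j) (('D_h f (x + t *: h)) 0 j).
  by move=> /seg/dP[Ut _]; exact: C1_on_line_derivable fU Ut.
have [||c c01 fc] := @MVT_segment R (fun s : R => f (x + s *: h) 0 j)
    (fun t : R => ('D_h f (x + t *: h)) 0 j) 0 1 ler01.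
- by move=> t; rewrite in_itv/= => t01; apply: dt; lra.
- by apply: derivable_within_continuous => t; rewrite in_itv/= => /dt[].
have {}c01 : 0 <= c <= 1 by move: c01; rewrite in_itv.
have [Uc /= Dc] := dP _ (seg _ c01).
move: fc; rewrite scale0r addr0 scale1r subr0 mulr1 [x + h]addrC subrK => fc.
have -> : (f y - f x - 'd f x0 h) 0 j =
    (\sum_i h 0 i *: ('D_('e_i) f (x + c *: h) - 'D_('e_i) f x0)) 0 j.
  have Dch : 'D_h f (x + c *: h) = \sum_i h 0 i *: 'D_('e_i) f (x + c *: h).
    by have [dfc _] := fU _ Uc; rewrite deriveE// diffE.
  under eq_bigr do rewrite scalerBr.
  rewrite sumrB -Dch -(diffE _ h Ux0).
  by rewrite mxE [in LHS]mxE [(- f x) 0 j]mxE fc [in RHS]mxE.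
apply: le_trans (coord_le_norm _ _) _.
apply: le_trans (ler_norm_sum _ _ _) _.
apply: (@le_trans _ _ (\sum_(i < m) e' * `|h|)).
  apply: ler_sum => i _; rewrite normrZ mulrC ler_pM//.
    by rewrite distrC ltW.
  exact: coord_le_norm.
rewrite sumr_const card_ord -mulr_natr mulrAC ler_wpM2r//.
by rewrite -mulrA ger_pMr// mulrC ler_pdivrMr// mul1r ler_nat.
Qed.

Lemma C1_on_lipschitz (R : realType) (m n : nat) (U : set 'rV[R]_m)
  (f : 'rV[R]_m -> 'rV[R]_n) (x0 : 'rV[R]_m) :
  open U -> C1_on U f -> U x0 ->
  exists d M : R, [/\ 0 < d, 0 < M & forall x y : 'rV[R]_m,
    `|x - x0| < d -> `|y - x0| < d -> `|f y - f x| <= M * `|y - x|].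
Proof.
move=> oU fU Ux0; have [df _] := fU _ Ux0.
have [d d0 fd] := C1_on_strict_diff oU fU Ux0 ltr01.
have : bounded_near ('d f x0) (nbhs (0 : 'rV[R]_m)).
  exact/continuous_linear_bounded/diff_continuous.
move=> /linear_boundedP/pinfty_ex_gt0[M M0 dM].
exists d, (M + 1); split => //; first by rewrite addr_gt0.
move=> x y xd yd; rewrite -(subrK ('d f x0 (y - x)) (f y - f x)).
apply: le_trans (ler_normD _ _) _; rewrite addrC mulrDl.
by rewrite lerD// fd.
Qed.

(** * A line crossing a narrow sector of the cone *)

(** With [c = dot e e'], the distance from [r' *: e'] to the line of [e] is [|r'|] times the root of
    [1 - c ^+ 2], and [c >= 0] makes this comparable to the length of [r' *: (e' - e)]. The sign of
    [c] excludes antipodal directions, for which opposite [r] and [r'] give the same point. *)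
Lemma radial_estimates (R : realType) (n : nat) (e e' : 'rV[R]_n) (r r' : R) :
  dot e e = 1 -> dot e' e' = 1 -> 0 <= dot e e' ->
  enorm (r' *: (e' - e)) <= 2 * enorm (r' *: e' - r *: e) /\
  `|r' - r| <= 2 * enorm (r' *: e' - r *: e).
Proof.
move=> ee ee' c0; set D := r' *: e' - r *: e.
have DD : dot D D = r' ^+ 2 - 2 * r * r' * dot e e' + r ^+ 2.
  by rewrite /D !dotE ee ee' (dotC e' e); ring.
have dd : dot (e' - e) (e' - e) = 2 - 2 * dot e e'.
  by rewrite !dotE ee ee' (dotC e' e); ring.
have c1 : dot e e' <= 1 by have := dot_ge0 (e' - e); rewrite dd; lra.
have D0 : 0 <= 2 * enorm D by rewrite mulr_ge0// enorm_ge0.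
move: (dot e e') c0 c1 DD dd => c c0 c1 DD dd.
split; rewrite -(@ler_pXn2r _ 2)// ?nnegrE ?enorm_ge0//
  [leRHS]exprMn (sqr_enorm D) DD.
- rewrite sqr_enorm dotZl dotZr dd.
  have : 0 <= (r - r' * c) ^+ 2 by exact: sqr_ge0.
  have : 0 <= r' ^+ 2 * (c * (1 - c)).
    by rewrite mulr_ge0 ?sqr_ge0// mulr_ge0//; lra.
  nra.
- rewrite real_normK ?num_real//.
  (* The difference of the two sides is affine in [c], hence the mean, with weights [c] and [1 - c],
     of its values at 1 and 0. *)
  rewrite -subr_ge0 [leRHS](_ : _ = 3 * (c * (r' - r) ^+ 2) +
    (1 - c) * ((r' + r) ^+ 2 + 2 * (r' ^+ 2 + r ^+ 2))); last by ring.
  apply: addr_ge0; first by rewrite mulr_ge0// mulr_ge0// sqr_ge0.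
  rewrite mulr_ge0 ?subr_ge0// addr_ge0 ?sqr_ge0//.
  by rewrite mulr_ge0// addr_ge0// sqr_ge0.
Qed.

(** The radius [d] is fixed before the apex, the line and [delta], so that a finite cover by such
    balls has a size independent of them. *)
Lemma cone_line_crossing (R : realType) (m n : nat) (A U : set 'rV[R]_m)
  (V : set 'rV[R]_n) (f : 'rV[R]_m -> 'rV[R]_n) (g : 'rV[R]_n -> 'rV[R]_m)
  (x0 : 'rV[R]_m) (s : R) :
  open U -> A `<=` U -> C1_on U f ->
  open V -> f @` A `<=` V -> C1_on V g ->
  (forall x, A x -> g (f x) = x) -> f @` A `<=` @unit_sphere R n ->
  A x0 -> 0 < s ->
  exists2 d : R, 0 < d &
  forall (z b v : 'rV[R]_n) (delta : R), 0 <= delta ->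
  (forall w : 'rV[R]_n, (w <= f x0 + 'J f x0)%MS -> s * `|v| <= `|v - w|) ->
  forall (x x' : 'rV[R]_m) (r r' t t' : R),
  A x -> A x' -> `|x - x0| < d -> `|x' - x0| < d ->
  `|z + r *: f x - (b + t *: v)| <= 2 * delta ->
  `|z + r' *: f x' - (b + t' *: v)| <= 2 * delta ->
  `|t' - t| * `|v| <= 12 / s * delta.
Proof.
move=> oU AU fU oV AV gV gK AS Ax0 s0.
have Ux0 := AU _ Ax0; have Vx0 : V (f x0) by apply: AV; exists x0.
have [dg [M [dg0 M0 gM]]] := C1_on_lipschitz oV gV Vx0.
have N0 : 0 <= n%:R :> R by exact: ler0n.
(* The last term keeps K1 positive when n = 0. *)
pose K1 := 2 * n%:R + 2 * M * n%:R + 1 : R.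
have K10 : 0 < K1 by rewrite /K1 ltr_wpDl// addr_ge0// !mulr_ge0// ltW.
(* The linearisation error will be at most [ep * K1] times the size of [D], and
   [ep * K1 = s / (2 * (1 + s))] lies below both 1/2 and [s / 2], small enough to be absorbed at the
   end. *)
pose ep := s / (2 * (1 + s)) / K1.
have ep0 : 0 < ep by rewrite !divr_gt0// mulr_gt0// addr_gt0.
have [d1 d10 fd1] := C1_on_strict_diff oU fU Ux0 ep0.
(* In order: values of [f] stay where [g] is Lipschitz; the direction [f x] is close to [f x0]; two
   such directions are at Euclidean distance at most 1, hence have a nonnegative dot product. *)
pose ep2 := Num.min dg (Num.min ep (2 * (n%:R + 1))^-1).
have ep20 : 0 < ep2.
  by rewrite !lt_min dg0 ep0 invr_gt0 mulr_gt0// ltr_wpDl.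
have fcont : {for x0, continuous f}.
  by have [df _] := fU _ Ux0; exact: differentiable_continuous.
have /nbhs_normP[d2 /= d20 fd2] : \forall y \near x0, `|f x0 - f y| < ep2.
  exact: (cvgrPdist_lt _ _).1 fcont _ ep20.
exists (Num.min d1 d2) => [|z b v delta delta0 vW x x' r r' t t' Ax Ax'].
  by rewrite lt_min d10.
rewrite !lt_min => /andP[xd1 xd2] /andP[x'd1 x'd2] yt yt'.
have near_x0 y : `|y - x0| < d2 ->
    [/\ `|f y - f x0| < dg, `|f y - f x0| < ep &
        `|f y - f x0| < (2 * (n%:R + 1))^-1].
  by rewrite distrC => /fd2 /=; rewrite distrC !lt_min => /and3P[].
have [xdg xep xN] := near_x0 _ xd2; have [x'dg x'ep x'N] := near_x0 _ x'd2.
have dotff y : A y -> dot (f y) (f y) = 1.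
  move=> Ay; have : unit_sphere (f y) by apply: AS; exists y.
  by rewrite /unit_sphere /= -sqr_enorm => ->; rewrite expr1n.
set e := f x in yt xdg xep xN *; set e' := f x' in yt' x'dg x'ep x'N *.
have ee : dot e e = 1 by exact: dotff.
have ee' : dot e' e' = 1 by exact: dotff.
have e'e : enorm (e' - e) <= 1.
  apply: le_trans (enorm_le_norm _) _.
  apply: (@le_trans _ _ (n%:R * (n%:R + 1)^-1)).
    rewrite ler_wpM2l// -(subrK (f x0) e') -addrA.
    apply: le_trans (ler_normD _ _) _; rewrite (distrC (f x0) e).
    by move: xN x'N; rewrite invfM; lra.
  by rewrite ler_pdivrMr ?ltr_wpDl// mul1r lerDl.
have c0 : 0 <= dot e e'.
  have : enorm (e' - e) ^+ 2 <= 1 by rewrite expr_le1// enorm_ge0.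
  by rewrite sqr_enorm !dotE ee ee' (dotC e' e); lra.
have [] := radial_estimates r r' ee ee' c0.
set D := r' *: e' - r *: e => De Dr.
set h := x' - x.
have DN : enorm D <= n%:R * `|D| by exact: enorm_le_norm.
have hM : `|r'| * `|h| <= 2 * M * n%:R * `|D|.
  have : `|h| <= M * `|e' - e|.
    by rewrite /h -(gK _ Ax) -(gK _ Ax'); exact: gM.
  have := norm_le_enorm (r' *: (e' - e)); rewrite normrZ => re hle.
  apply: (@le_trans _ _ (`|r'| * (M * `|e' - e|))); first by rewrite ler_wpM2l.
  rewrite mulrCA [leRHS](_ : _ = M * (2 * (n%:R * `|D|))); last by ring.
  by rewrite ler_wpM2l ?(ltW M0)//; lra.
pose w := (r' - r) *: f x0 + r' *: 'd f x0 h.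
have wW : (w <= f x0 + 'J f x0)%MS.
  rewrite /w addmx_sub_adds ?scalemx_sub//.
  by rewrite -[_ h](mul_rV_lin1 ('d f x0)) submxMl.
(* The first term is small because [f x] is near [f x0], the second by strict differentiability. *)
have E : D - w = (r' - r) *: (e - f x0) + r' *: (e' - e - 'd f x0 h).
  by rewrite /D /w; move: ('d f x0 h) => q; apply/rowP => i; rewrite !mxE; ring.
have DwE : `|D - w| <= ep * K1 * `|D|.
  rewrite E; apply: le_trans (ler_normD _ _) _; rewrite !normrZ.
  apply: (@le_trans _ _ (2 * n%:R * `|D| * ep + `|r'| * (ep * `|h|))).
    rewrite lerD//.
      by rewrite ler_pM// ?(ltW xep)//; lra.
    by rewrite ler_wpM2l// fd1.
  rewrite (mulrCA `|r'|).
  apply: (@le_trans _ _ (2 * n%:R * `|D| * ep + ep * (2 * M * n%:R * `|D|))).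
    by apply: lerD => //; apply: ler_wpM2l => //; exact: ltW.
  have epD : 0 <= ep * `|D| by apply: mulr_ge0 => //; exact: ltW.
  rewrite [leRHS](_ : _ = 2 * n%:R * `|D| * ep + ep * (2 * M * n%:R * `|D|) +
    ep * `|D|); last by rewrite /K1; ring.
  by rewrite lerDl.
set tau := t' - t.
have tauD : `|tau *: v - D| <= 4 * delta.
  have -> : tau *: v - D = (z + r *: e - (b + t *: v)) -
      (z + r' *: e' - (b + t' *: v)).
    by rewrite /tau /D; apply/rowP => i; rewrite !mxE; ring.
  by apply: le_trans (ler_normB _ _) _; lra.
have stau : s * `|tau *: v| <= `|tau *: v - w|.
  have [->|tau0] := eqVneq tau 0; first by rewrite scale0r normr0 mulr0.
  have -> : tau *: v - w = tau *: (v - tau^-1 *: w).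
    by rewrite scalerBr scalerA divff// scale1r.
  by rewrite !normrZ mulrCA ler_wpM2l// vW// scalemx_sub.
have Dtau : `|D| <= `|tau *: v| + 4 * delta.
  rewrite -{1}(subrK (tau *: v) D); apply: le_trans (ler_normD _ _) _.
  by rewrite distrC addrC lerD2l.
have split_le : `|tau *: v - w| <= 4 * delta + `|D - w|.
  rewrite -(subrK D (tau *: v)) -addrA.
  by apply: le_trans (ler_normD _ _) _; rewrite lerD2r.
rewrite -normrZ mulrAC ler_pdivlMr//.
have s1 : 1 + s != 0 by rewrite gt_eqF// addr_gt0.
have epK : ep * K1 * (2 * (1 + s)) = s.
  by rewrite /ep; field; rewrite s1 gt_eqF.
(* In the new names, [s * T <= 4 * delta + q * D'] with [D' <= T + 4 * delta]. As [q <= s / 2] and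
   [q <= 1 / 2], this gives [s * T / 2 <= 6 * delta], whence the constant 12. *)
move: (`|tau *: v|) (`|D|) (`|tau *: v - w|) (`|D - w|) (ep * K1) (normr_ge0 D)
  stau Dtau split_le DwE epK => T D' X Y q D'0 sT DT XY YD qs.
have q1 : q <= 1 by nra.
have qs2 : 2 * q <= s by nra.
have q0 : 0 <= q by nra.
have : q * D' <= q * T + 4 * delta * q by nra.
have : 4 * delta * q <= 2 * delta by nra.
by nra.
Qed.

(** * Coverings by finitely many boxes and compactness of the cube *)

(** The list is padded to a sequence by the one-point box [(0, 0)]. Its volume is 0 because [0 < n];
    an empty product would be 1. *)
Lemma lebesgue_n_le_sum_box (R : realType) (n : nat) (A : set 'rV[R]_n)
  (s : seq ('rV[R]_n * 'rV[R]_n)) : (0 < n)%N ->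
  (forall x, A x -> exists2 ab, ab \in s & box ab x) ->
  (lebesgue_n A <= (\sum_(ab <- s) box_volume ab)%:E)%E.
Proof.
move=> n0 As; pose ab k := nth (0, 0) s k.
apply: ereal_inf_lbound; exists ab => /=.
  move=> x /As[c cs cx]; exists (index c s) => //.
  by rewrite /ab nth_index.
have vol0 c : (0%:E <= (box_volume c : R)%:E)%E.
  by rewrite lee_fin; apply: prodr_ge0 => i _; rewrite le_max lexx.
rewrite (nneseries_split 0%N (size s)); last by move=> k _; exact: vol0.
rewrite add0n eseries0 ?adde0; last first.
  move=> k sk _; rewrite /ab nth_default// /box_volume.
  rewrite (bigD1 (Ordinal n0))//= subrr maxxx mul0r//.
by rewrite sumEFin (big_nth (0, 0)).
Qed.

Definition cube_box (R : realType) (n : nat) (q : 'rV[R]_n) (rho : R) :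
  'rV[R]_n * 'rV[R]_n := (q - const_mx rho, q + const_mx rho).

Lemma cube_boxP (R : realType) (n : nat) (q x : 'rV[R]_n) (rho : R) :
  `|x - q| <= rho -> box (cube_box q rho) x.
Proof.
move=> xq i; have := le_trans (coord_le_norm (x - q) i) xq.
by rewrite /cube_box /= !mxE ler_norml; lra.
Qed.

Lemma cube_box_volume (R : realType) (n : nat) (q : 'rV[R]_n) (rho : R) :
  0 <= rho -> box_volume (cube_box q rho) = (2 * rho) ^+ n.
Proof.
move=> rho0; rewrite -[n in RHS]card_ord -prodr_const; apply: eq_bigr => i _.
rewrite /cube_box /= !mxE.
have -> : q 0 i + rho - (q 0 i - rho) = 2 * rho by ring.
by rewrite max_r// mulr_ge0.
Qed.

Lemma unit_cube_compact (R : realType) (m : nat) : compact (@unit_cube R m).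
Proof.
have -> : @unit_cube R m = [set x | forall i, `[0, 1]%classic (x ord0 i)].
  by apply/seteqP; split=> x xc i; have := xc i; rewrite /= in_itv.
by apply: (@rV_compact R m (fun=> `[0, 1]%classic)) => i;
  exact: segment_compact.
Qed.

(** * Assembly over a finite cover of the parameter cube *)

Unset Implicit Arguments.

Theorem theorem1p28 (R : realType) (n : nat) (hn : (3 <= n)%N)
  (f : 'rV[R]_(n - 2) -> 'rV[R]_n)
  (Sigma : set 'rV[R]_n) (hSigma : Sigma = f @` @unit_cube R (n - 2))
  (hsphere : Sigma `<=` @unit_sphere R n)
  (hf : C2_diffeo_onto_image (@unit_cube R (n - 2)) f)
  (hgeod : n = 3%N -> forall x u : 'rV[R]_(n - 2),
     @unit_cube R (n - 2) x -> u != 0 -> geodesic_curvature f x u != 0)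
  (hsec : (4 <= n)%N -> forall x u v : 'rV[R]_(n - 2),
     @unit_cube R (n - 2) x -> row_free (col_mx u v) ->
     1 < sectional_curvature f x u v) :
  exists2 c : R, 0 < c &
  forall a : R, 0 < a ->
  exists C : R,
  forall delta : R, 0 < delta -> delta <= c * a ->
  forall z b v : 'rV[R]_n, v != 0 ->
  (forall p : 'rV[R]_n, (cone Sigma z `\ z) p ->
   forall W : 'M[R]_n, cone_tangent f z p W -> a <= angle v W) ->
  (lebesgue_n (thickening delta (cone Sigma z)
               `&` thickening delta (line b v))
   <= (C * delta ^+ n)%:E)%E.
Proof.
exists 1 => // a a0; have n0 : (0 < n)%N by exact: leq_trans hn.
have [s0 s0_gt0 angle_s0] := angle_transversal a0.
(* The factor [n] passes from Euclidean transversality to the sup norm. *)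
pose s := s0 / n%:R; have s_gt0 : 0 < s by rewrite divr_gt0// ltr0n.
case: hf => [[U [oU AU [fU _]]] [g [[V [oV AV [gV _]]] gK]]].
rewrite {}hSigma in hsphere *.
set A := @unit_cube R (n - 2) in AU AV gK hsphere *.
pose good x0 d := forall (z b v : 'rV[R]_n) (delta : R), 0 <= delta ->
  (forall w : 'rV[R]_n, (w <= f x0 + 'J f x0)%MS -> s * `|v| <= `|v - w|) ->
  forall (x x' : 'rV[R]_(n - 2)) (r r' t t' : R),
  A x -> A x' -> `|x - x0| < d -> `|x' - x0| < d ->
  `|z + r *: f x - (b + t *: v)| <= 2 * delta ->
  `|z + r' *: f x' - (b + t' *: v)| <= 2 * delta ->
  `|t' - t| * `|v| <= 12 / s * delta.
have /choice[d dP] : forall x0, exists d, 0 < d /\ (A x0 -> good x0 d).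
  move=> x0; have [Ax0|nAx0] := pselect (A x0); last by exists 1.
  have [d d0 dP] :=
    cone_line_crossing oU AU fU oV AV gV gK hsphere Ax0 s_gt0.
  by exists d; split => // _; exact: dP.
have : finite_subset_cover A (fun x0 => ball x0 (d x0)) A.
  have := @unit_cube_compact R (n - 2); rewrite compact_cover; apply.
    by move=> x _; apply: ball_open; case: (dP x).
  by move=> x Ax; exists x => //; apply: ballxx; case: (dP x).
move=> [D' DA DP]; pose D := finmap.enum_fset D'.
(* A point of the intersection is within [delta] of the line, at a parameter whose point is within
   [12 / s * delta] of the reference point of its ball. *)
pose K := 1 + 12 / s; have K0 : 0 <= K by rewrite addr_ge0// divr_ge0// ltW.
exists ((size D)%:R * (2 * K) ^+ n) => delta delta0 _ z b v v0 transv.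
(* These are the parameters at which the line comes within [2 * delta], one [delta] for each
   thickening, of the sector over the ball around [x0]. *)
pose hits x0 t := exists x r, [/\ A x, `|x - x0| < d x0 &
  `|z + r *: f x - (b + t *: v)| <= 2 * delta].
(* Any hit serves as reference, since all hits of one ball are close together. Without a hit the
   default 0 only adds a box to the cover. *)
pose t_ x0 := xget 0 [set t | hits x0 t].
pose bx x0 := cube_box (b + t_ x0 *: v) (K * delta).
apply: (@le_trans _ _ (\sum_(ab <- map bx D) box_volume ab)%:E); last first.
  rewrite lee_fin big_map (eq_bigr (fun=> (2 * (K * delta)) ^+ n)).
    by rewrite big_const_seq count_predT iter_addr_0 -[leLHS]mulr_natl -mulrA
      -exprMn mulrA.
  by move=> x0 _; rewrite cube_box_volume// mulr_ge0// ltW.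
apply: lebesgue_n_le_sum_box => // q [[y [p [r [[x Ax <-] _ ->]]] qy]].
move=> [_ [t _ <-] qt].
have [x0 /= x0D xx0] := DP _ Ax.
have Ax0 : A x0 by have := DA _ x0D; rewrite inE.
have hit : hits x0 t.
  exists x, r; split => //.
    by move: xx0; rewrite -ball_normE /= distrC.
  rewrite -(subrK q (z + r *: f x)) -addrA.
  apply: le_trans (ler_normD _ _) _; rewrite distrC.
  by have := norm_le_enorm (q - (z + r *: f x));
     have := norm_le_enorm (q - (b + t *: v)); lra.
have hit_ : hits x0 (t_ x0) by rewrite /t_; case: xgetP => // /(_ t).
exists (bx x0); first exact: map_f.
apply: cube_boxP.
(* The tangent hyperplane is constant along a generator, so the angle condition is used at [r = 1],
   at the point [z + f x0], which differs from [z] as [f x0] is a unit vector. *)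
have transw (w : 'rV[R]_n) : (w <= f x0 + 'J f x0)%MS -> s * `|v| <= `|v - w|.
  move=> wW; have fx0 : enorm (f x0) = 1 by apply: hsphere; exists x0.
  have cx0 : (cone (f @` A) z `\ z) (z + f x0).
    split.
      by exists (f x0), 1; split; [exists x0|lra|rewrite scale1r].
    move=> /= zf; have : f x0 = 0 by apply: (addrI z); rewrite addr0.
    move=> f0; move: fx0; rewrite f0 /enorm /dot big1 ?sqrtr0.
      by move=> /esym/eqP; rewrite oner_eq0.
    by move=> i _; rewrite mxE mul0r.
  have W : cone_tangent f z (z + f x0) (f x0 + 'J f x0)%MS.
    by exists x0, 1; split; rewrite ?scale1r ?oner_neq0//; lra.
  have := angle_s0 _ _ _ _ (transv _ cx0 _ W) w wW => sv.
  rewrite /s mulrAC ler_pdivrMr ?ltr0n// [leRHS]mulrC.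
  apply: le_trans (enorm_le_norm _); apply: le_trans sv.
  by rewrite ler_wpM2l ?(ltW s0_gt0)// norm_le_enorm.
have [x1 [r1 [Ax1 x1x0 ht1]]] := hit_; have [x2 [r2 [Ax2 x2x0 ht2]]] := hit.
have := (dP x0).2 Ax0 z b v delta (ltW delta0) transw _ _ _ _ _ _
  Ax1 Ax2 x1x0 x2x0 ht1 ht2.
move=> tt; have -> : q - (b + t_ x0 *: v) =
    (q - (b + t *: v)) + (t - t_ x0) *: v.
  by apply/rowP => i; rewrite !mxE; ring.
apply: le_trans (ler_normD _ _) _; rewrite normrZ /K.
by have := norm_le_enorm (q - (b + t *: v)); lra.
Qed.
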